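(* Let $n$ be a natural number. An $n$-ary logical connective $\mathcal{C}$ satisfies the reflection principle if and only if $\mathcal{C}$ is a synthetic connective.
   Context: Setting: a sequent calculus (in the style of linear logic, without implication and without negation inside connectives) with sequents $\Gamma \vdash \Delta$, identity axiom and cut; visibility is assumed (active formulas of a connective's rule are the only formulas on their side). An $n$-ary logical connective $\mathcal{C}$ is a pair of sets of left and right rules introducing $\mathcal{C}(A_1,\dots,A_n)$ in the antecedent, resp. succedent, with premisses built from formulas among $A_1,\dots,A_n$ and context variables, satisfying the main step of cut elimination (a cut on $\mathcal{C}(A_1,\dots,A_n)$ between conclusions of a right and a left rule reduces to cuts on the $A_i$). Reflection principle: take rules of one side as formation rules, e.g. $\Gamma_1\vdash A_{11},\dots,A_{1k_1}\ \cdots\ \Gamma_m\vdash A_{m1},\dots,A_{mk_m}$ / $\Gamma'\vdash\mathcal{C}(A_1,\dots,A_n)$; the definitional equation states the conclusion holds iff all premisses of the formation rule(s) hold (premisses of several rules joined by ``and''); implicit reflection rules come from the ``only if'' direction, and explicit reflection rules by substituting $\mathcal{C}(A_1,\dots,A_n)$ for the context and replacing active formulas by contexts via cut (e.g. $A_{ij}\vdash\Delta$ / $\mathcal{C}(A_1,\dots,A_n)\vdash\Delta$). The equation is solvable if the main step of cut elimination holds between the explicit reflection rules and the formation rule(s); $\mathcal{C}$ satisfies the reflection principle if its rules are the formation rule(s) and explicit reflection rules of a solvable definitional equation. Synthetic connective: $\mathcal{C}$ is synthetic if, for some $m\in\mathbb{N}$, $k_1,\dots,k_m$ and $A_{pq}\in\{A_1,\dots,A_n\}$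 ($1\le p\le m$, $1\le q\le k_p$), its rules are an instance of either Scheme I: a single right rule with premisses $\Gamma\vdash A_{11},\dots,A_{1k_1}$, …, $\Gamma\vdash A_{m1},\dots,A_{mk_m}$ (same context $\Gamma$) and conclusion $\Gamma\vdash\mathcal{C}(A_1,\dots,A_n)$, together with, for each $1\le i\le m$, a left rule with premiss $A_{i1},\dots,A_{ik_i}\vdash\Delta$ and conclusion $\mathcal{C}(A_1,\dots,A_n)\vdash\Delta$; or Scheme II (the dual): a single left rule with premisses $A_{11},\dots,A_{1k_1}\vdash\Delta$, …, $A_{m1},\dots,A_{mk_m}\vdash\Delta$ and conclusion $\mathcal{C}(A_1,\dots,A_n)\vdash\Delta$, together with, for each $1\le i\le m$, a right rule with premiss $\Gamma\vdash A_{i1},\dots,A_{ik_i}$ and conclusion $\Gamma\vdash\mathcal{C}(A_1,\dots,A_n)$.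
   Formalization: As printed, par with the usual cut is a counterexample; so either cut acts on a whole list of A_i at once, or the rule opposite the formation rule has premisses A_ij ⊢ Δ_j and conclusion C ⊢ Δ_1,…,Δ_k. At least one formation rule is required, each with a nonempty context in its conclusion. *)

(* Defs.v *)
From HB Require Import structures.
From mathcomp Require Import all_boot.
From mathcomp Require Import finmap multiset.
From mathcomp Require Import boolp classical_sets.

Set Implicit Arguments.
Unset Strict Implicit.
Unset Printing Implicit Defensive.

Local Open Scope classical_set_scope.
Local Open Scope mset_scope.

(* The language is generated by the connective under study; the atoms stand
   for all formulas with another outermost connective. *)
Inductive formula (n : nat) : Type :=
| Atom of nat
| Conn of {ffun 'I_n -> formula n}.
Arguments Atom {n}.

HB.instance Definition _ n := gen_eqMixin (formula n).
HB.instance Definition _ n := gen_choiceMixin (formula n).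

(* Antecedent and succedent are multisets, so exchange is built in; there is
   no weakening and no contraction. *)
Definition sequent n : Type := ({mset formula n} * {mset formula n})%type.

Definition msum (T : Type) (K : choiceType) (f : T -> {mset K}) (s : seq T) :
  {mset K} := \big[msetD/mset0]_(x <- s) f x.

(* How a list A_1, ..., A_k of formulas is cut.
   - [One_by_one]: the usual cut rule, on one formula occurrence.  The list
     on the right of  Gamma |- A_1, ..., A_k  is replaced by contexts by
     cutting with  A_1 |- Delta_1, ..., A_k |- Delta_k, giving
     Gamma |- Delta_1, ..., Delta_k.
   - [Simultaneous]: cut acts on a whole list at once.  The list is replaced
     by a context by cutting with the single sequent A_1, ..., A_k |- Delta,
     giving  Gamma |- Delta.
   For k = 1 the two agree. *)
Inductive cut_style := One_by_one | Simultaneous.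

Definition blocks (d : cut_style) (T : Type) (X : seq T) : seq (seq T) :=
  match d with
  | One_by_one => [seq [:: x] | x <- X]
  | Simultaneous => [:: X]
  end.

Definition cuttable (d : cut_style) (T : Type) (X : seq T) : bool :=
  match d with
  | One_by_one => size X == 1
  | Simultaneous => true
  end.

(* Derivability from the sequents of [H] by identity and cuts on the
   immediate subformulas A_i := t i of the principal formula. *)
Inductive derivable (d : cut_style) (n : nat) (t : {ffun 'I_n -> formula n})
    (H : set (sequent n)) : sequent n -> Prop :=
| Hyp S : H S -> derivable d t H S
| Identity B : derivable d t H ([mset B], [mset B])
| Cut (X : seq 'I_n) G D G' D' :
    cuttable d X ->
    derivable d t H (G, D `+` msum (fun i => [mset t i]) X) ->
    derivable d t H (msum (fun i => [mset t i]) X `+` G', D') ->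
    derivable d t H (G `+` G', D `+` D').

(* Sub i is A_i, Prin is C(A_1, ..., A_n), Ctx v is a context variable. *)
Inductive symbol (n : nat) : Type :=
| Sub of 'I_n
| Prin
| Ctx of nat.
Arguments Prin {n}.
Arguments Ctx {n}.

HB.instance Definition _ n := gen_eqMixin (symbol n).
HB.instance Definition _ n := gen_choiceMixin (symbol n).

Definition schema n : Type := (seq (symbol n) * seq (symbol n))%type.

Record rule (n : nat) : Type :=
  Rule { prems : seq (schema n); concl : schema n }.

Inductive side := Lft | Rgt.

Definition opp (s : side) : side := if s is Rgt then Lft else Rgt.

(* [on s X Y] has Y on side s and X on the other side: it is X |- Y for
   s = Rgt and Y |- X for s = Lft. *)
Definition on (s : side) (T : Type) (X Y : T) : T * T :=
  if s is Rgt then (X, Y) else (Y, X).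

Definition on_side (s : side) (T : Type) (S : T * T) : T :=
  if s is Rgt then S.2 else S.1.

Definition off_side (s : side) (T : Type) (S : T * T) : T :=
  if s is Rgt then S.1 else S.2.

(* For s = Rgt:  Gamma_1 |- A_11, ..., A_1k_1   ...   Gamma_m |- A_m1, ..., A_mk_m
                 ----------------------------------------------------------------
                                   Gamma' |- C(A_1, ..., A_n)
   with Gamma' a list of distinct context variables, and the Gamma_i arbitrary
   lists of context variables.  By visibility the A_ij, respectively C, stand
   alone on their side. *)
Definition introduces n (s : side) (r : rule n) : Prop :=
  (exists2 G : seq nat, uniq G & concl r = on s (map Ctx G) [:: Prin]) /\
  (forall p, p \in prems r -> exists (G : seq nat) (acts : seq 'I_n),
     p = on s (map Ctx G) (map (@Sub n) acts)).

Definition symbol_inst n (t : {ffun 'I_n -> formula n})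
    (c : nat -> {mset formula n}) (x : symbol n) : {mset formula n} :=
  match x with
  | Sub i => [mset t i]
  | Prin => [mset Conn t]
  | Ctx v => c v
  end.

Definition schema_inst n t c (S : schema n) : sequent n :=
  (msum (symbol_inst t c) S.1, msum (symbol_inst t c) S.2).

Definition prems_inst n t c (r : rule n) : set (sequent n) :=
  [set schema_inst t c p | p in [set` prems r]].

(* An inference figure: the set of its premisses, and its conclusion. *)
Definition rule_inst n t c (r : rule n) : set (sequent n) * sequent n :=
  (prems_inst t c r, schema_inst t c (concl r)).

(* Rules are identified when they have the same inference figures: the names
   of context variables, the order and repetition of premisses, and writing
   one context as the juxtaposition of several are immaterial. *)
Definition same_rule n (r r' : rule n) : Prop :=
  forall t : {ffun 'I_n -> formula n},
    range (fun c => rule_inst t c r) = range (fun c => rule_inst t c r').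

Definition same_rules n (R R' : set (rule n)) : Prop :=
  (forall r, R r -> exists2 r', R' r' & same_rule r r') /\
  (forall r', R' r' -> exists2 r, R r & same_rule r r').

(* Main step of cut elimination between right rules R and left rules L:
   if instances of r in R and l in L conclude  G |- C(A_1, ..., A_n)  and
   C(A_1, ..., A_n) |- D, then  G |- D  follows from their premisses by cuts
   on the A_i. *)
Definition main_step (d : cut_style) n (R L : set (rule n)) : Prop :=
  forall r l, R r -> L l ->
  forall (t : {ffun 'I_n -> formula n}) (c c' : nat -> {mset formula n})
         (G D : {mset formula n}),
    schema_inst t c (concl r) = (G, [mset Conn t]) ->
    schema_inst t c' (concl l) = ([mset Conn t], D) ->
    derivable d t (prems_inst t c r `|` prems_inst t c' l) (G, D).

Record connective (d : cut_style) (n : nat) : Type := Connective {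
  rules : side -> set (rule n);
  rules_introduce : forall s r, rules s r -> introduces s r;
  rules_main_step : main_step d (rules Rgt) (rules Lft)
}.

(* The context variables in K are replaced by C(A_1, ..., A_n), the others
   by the empty context. *)
Definition subst_ctx n (K : pred nat) (X : seq (symbol n)) : seq (symbol n) :=
  flatten [seq (if x is Ctx v then nseq (K v) Prin else [:: x]) | x <- X].

(* From  L |- X  (s = Rgt), the rule obtained by replacing the formulas X by
   contexts via cut: with X_1, ..., X_b the blocks of X,
        X_1 |- Delta_1   ...   X_b |- Delta_b
        -------------------------------------
             L |- Delta_1, ..., Delta_b
   Sides are exchanged for s = Lft. *)
Definition contextualize (d : cut_style) n (s : side) (L X : seq (symbol n)) :
    rule n :=
  let b := size (blocks d X) in
  Rule [seq on s (nth [::] (blocks d X) j) [:: Ctx j] | j <- iota 0 b]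
       (on s L (map Ctx (iota 0 b))).

(* Formation rules F on side s.  There is at least one, and each has a
   context for which C(A_1, ..., A_n) can be substituted. *)
Definition formation_rules n (s : side) (F : set (rule n)) : Prop :=
  F !=set0 /\
  (forall r, F r -> introduces s r /\ off_side s (concl r) <> [::]).

(* The definitional equation: the conclusion of a formation rule holds iff all
   its premisses do.  These are the rules given by the "only if" direction. *)
Definition implicit_reflection n (F : set (rule n)) : set (rule n) :=
  [set i | exists r p, [/\ F r, p \in prems r & i = Rule [:: concl r] p]].

(* Substituting C(A_1, ..., A_n) for the context makes the premiss of an
   implicit reflection rule the identity axiom, so its conclusion holds under
   the same substitution; its active formulas are then replaced by contexts.
   When a premiss of a formation rule does not have the context of the
   conclusion, the result need not be a rule introducing C; C then cannot
   satisfy the reflection principle by means of that formation rule. *)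
Definition explicit_reflection (d : cut_style) n (s : side) (F : set (rule n)) :
    set (rule n) :=
  [set e | exists (S p : schema n) (K : pred nat),
     [/\ implicit_reflection F (Rule [:: S] p),
         subst_ctx K (off_side s S) = [:: Prin] &
         e = contextualize d s (subst_ctx K (off_side s p)) (on_side s p)]].

Definition solvable (d : cut_style) n (s : side) (F : set (rule n)) : Prop :=
  match s with
  | Rgt => main_step d F (explicit_reflection d Rgt F)
  | Lft => main_step d (explicit_reflection d Lft F) F
  end.

Definition satisfies_reflection (d : cut_style) n (C : connective d n) : Prop :=
  exists (s : side) (F : set (rule n)),
    [/\ formation_rules s F,
        solvable d s F,
        same_rules (rules C s) F &
        same_rules (rules C (opp s)) (explicit_reflection d s F)].

(* A = [:: [:: A_11; ...; A_1k_1]; ...; [:: A_m1; ...; A_mk_m]] *)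
Definition scheme_main n (s : side) (A : seq (seq 'I_n)) : rule n :=
  Rule [seq on s [:: Ctx 0] (map (@Sub n) acts) | acts <- A]
       (on s [:: Ctx 0] [:: Prin]).

(* For s = Rgt, the left rule
     A_i1, ..., A_ik_i |- Delta  /  C |- Delta           ([Simultaneous])
     A_i1 |- Delta_1  ...  A_ik_i |- Delta_k_i
        /  C |- Delta_1, ..., Delta_k_i                  ([One_by_one]). *)
Definition scheme_opp (d : cut_style) n (s : side) (acts : seq 'I_n) : rule n :=
  contextualize d s [:: Prin] (map (@Sub n) acts).

Definition instance_of_scheme (d : cut_style) n (s : side)
    (C : connective d n) (A : seq (seq 'I_n)) : Prop :=
  same_rules (rules C s) [set scheme_main s A] /\
  same_rules (rules C (opp s)) [set scheme_opp d s acts | acts in [set` A]].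

(* Scheme I is s = Rgt, Scheme II is s = Lft. *)
Definition synthetic (d : cut_style) n (C : connective d n) : Prop :=
  exists A : seq (seq 'I_n),
    instance_of_scheme Rgt C A \/ instance_of_scheme Lft C A.

(* Main.v *)
From mathcomp Require Import all_boot.
From mathcomp Require Import finmap multiset zify.
From mathcomp Require Import boolp classical_sets.
Require Import Defs.

Set Implicit Arguments.
Unset Strict Implicit.
Unset Printing Implicit Defensive.

Local Open Scope classical_set_scope.
Local Open Scope mset_scope.

(** If C has the rules of a scheme, then its main rule alone, taken as
    formation rule, has the rules of the opposite side as its explicit
    reflection rules, and solvability is the cut-elimination step of C itself.

    Conversely, an explicit reflection rule introduces C only if replacing a
    context variable by C leaves exactly one C in its conclusion; this forces
    all premisses of a formation rule to have the context of the conclusion,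
    so each formation rule is a main rule of a scheme.  Several formation rules
    must coincide: instantiate the cut between the first rule and an explicit
    reflection rule of the second with pairwise distinct atoms.  Since cuts
    preserve the difference of succedent and antecedent, the conclusion uses
    exactly one premiss of the former and each premiss of the latter once, and
    balancing the active formulas shows that the two lists are permutations of
    one another. *)

(** * Multiset sums and distinct atoms *)

Lemma msumE (T : Type) (K : choiceType) (f : T -> {mset K}) s x :
  msum f s x = \sum_(y <- s) f y x.
Proof.
rewrite /msum; elim: s => [|y s IHs]; first by rewrite !big_nil mset0E.
by rewrite !big_cons msetE2 IHs.
Qed.

Lemma msum_map (T U : Type) (K : choiceType) (f : U -> {mset K}) (g : T -> U) s :
  msum f (map g s) = msum (f \o g) s.
Proof. by rewrite /msum big_map. Qed.

Lemma msum1 (T : Type) (K : choiceType) (f : T -> {mset K}) x :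
  msum f [:: x] = f x.
Proof. by apply/msetP => y; rewrite msumE big_seq1. Qed.

Lemma perm_msum (T : eqType) (K : choiceType) (f : T -> {mset K}) s1 s2 :
  perm_eq s1 s2 -> msum f s1 = msum f s2.
Proof. by move=> eq_s; apply/msetP => x; rewrite !msumE (perm_big _ eq_s). Qed.

Lemma msum_single (T : eqType) (K : choiceType) (A : {mset K}) (x0 : T) s :
  uniq s -> x0 \in s ->
  msum (fun x => if x == x0 then A else mset0) s = A.
Proof.
move=> s_uniq s_x0; apply/msetP => y; rewrite msumE (bigD1_seq x0) //= eqxx.
by rewrite big1 ?addn0 // => x /negPf ->; rewrite mset0E.
Qed.

Lemma eq_Atom n i j : (Atom i == Atom j :> formula n) = (i == j).
Proof. by apply/eqP/eqP => [[]|->]. Qed.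

(** Only the atoms below [n] are used, so [Atom k] with [n <= k] stays free to tag contexts. *)
Definition atoms n : {ffun 'I_n -> formula n} := [ffun i : 'I_n => Atom i].

Lemma msum_atoms_ord n (X : seq 'I_n) y :
  msum (fun i => [mset atoms n i]) X (Atom (val y)) = count_mem y X.
Proof.
rewrite msumE -sum1_count [RHS]big_mkcond /=; apply: eq_bigr => i _.
by rewrite msetnE ffunE eq_Atom eq_sym.
Qed.

Lemma msum_atoms_ge n (X : seq 'I_n) k :
  n <= k -> msum (fun i => [mset atoms n i]) X (Atom k) = 0.
Proof.
move=> le_nk; rewrite msumE big1 // => i _; rewrite msetnE ffunE eq_Atom.
by rewrite gtn_eqF // (leq_trans (ltn_ord i)).
Qed.

(** * Sides and identification of rules *)

Lemma on_opp s (T : Type) (X Y : T) : on (opp s) X Y = on s Y X.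
Proof. by case: s. Qed.

Lemma onK s (T : Type) (X Y : T) : on_side s (on s X Y) = Y.
Proof. by case: s. Qed.

Lemma offK s (T : Type) (X Y : T) : off_side s (on s X Y) = X.
Proof. by case: s. Qed.

Lemma schema_inst_on n t c s (X Y : seq (symbol n)) :
  schema_inst t c (on s X Y) =
  on s (msum (symbol_inst t c) X) (msum (symbol_inst t c) Y).
Proof. by case: s. Qed.

Lemma msum_Ctx n t (c : nat -> {mset formula n}) G :
  msum (symbol_inst t c) (map Ctx G) = msum c G.
Proof. by rewrite msum_map. Qed.

Lemma msum_Sub n t (c : nat -> {mset formula n}) X :
  msum (symbol_inst t c) (map (@Sub n) X) = msum (fun i => [mset t i]) X.
Proof. by rewrite msum_map. Qed.

Lemma same_rule_sym n (r r' : rule n) : same_rule r r' -> same_rule r' r.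
Proof. by move=> rr' t. Qed.

Lemma same_rule_trans n (r2 r1 r3 : rule n) :
  same_rule r1 r2 -> same_rule r2 r3 -> same_rule r1 r3.
Proof. by move=> r12 r23 t; rewrite r12. Qed.

Lemma same_rules_trans n (R2 R1 R3 : set (rule n)) :
  same_rules R1 R2 -> same_rules R2 R3 -> same_rules R1 R3.
Proof.
move=> [R12 R21] [R23 R32]; split=> r.
  move=> /R12[r2 /R23[r3 R3r3 r23] r12].
  by exists r3 => //; apply: same_rule_trans r23.
move=> /R32[r2 /R21[r1 R1r1 r12] r23].
by exists r1 => //; apply: same_rule_trans r23.
Qed.

Lemma same_rule_inst n (r r' : rule n) t c :
  same_rule r r' -> exists2 c', prems_inst t c' r' = prems_inst t c r &
    schema_inst t c' (concl r') = schema_inst t c (concl r).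
Proof.
move=> /(_ t) rr'; have : range (fun c => rule_inst t c r) (rule_inst t c r).
  by exists c.
rewrite rr' => -[c' _ eq_inst]; exists c'.
  exact: (congr1 fst eq_inst).
exact: (congr1 snd eq_inst).
Qed.

Lemma same_ruleP n (r r' : rule n) :
  (forall t c, exists c', rule_inst t c' r' = rule_inst t c r) ->
  (forall t c, exists c', rule_inst t c' r = rule_inst t c r') ->
  same_rule r r'.
Proof.
move=> rr' r'r t; apply/seteqP; split=> _ [c _ <-].
  by have [c' <-] := rr' t c; exists c'.
by have [c' <-] := r'r t c; exists c'.
Qed.

Lemma main_step_same_rules d n (R R' L L' : set (rule n)) :
  same_rules R R' -> same_rules L L' -> main_step d R L -> main_step d R' L'.
Proof.
move=> [_ R'R] [_ L'L] RL r' l' /R'R[r Rr rr'] /L'L[l Ll ll'] t c c' G D.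
have [c1 <- <-] := same_rule_inst t c (same_rule_sym rr').
have [c2 <- <-] := same_rule_inst t c' (same_rule_sym ll').
exact: RL.
Qed.

(** * The main step of cut elimination, read through the balance of occurrences *)

Definition main_step_on d n (s : side) (F E : set (rule n)) : Prop :=
  if s is Rgt then main_step d F E else main_step d E F.

Lemma solvableE d n s (F : set (rule n)) :
  solvable d s F = main_step_on d s F (explicit_reflection d s F).
Proof. by case: s. Qed.

Lemma main_step_on_same_rules d n s (F F' E E' : set (rule n)) :
  same_rules F F' -> same_rules E E' ->
  main_step_on d s F E -> main_step_on d s F' E'.
Proof. by case: s => FF' EE'; apply: main_step_same_rules. Qed.

Lemma main_step_onP d n s (F E : set (rule n)) r l t c c' G D :
  main_step_on d s F E -> F r -> E l ->
  schema_inst t c (concl r) = on s G [mset Conn t] ->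
  schema_inst t c' (concl l) = on s [mset Conn t] D ->
  derivable d t (prems_inst t c r `|` prems_inst t c' l) (on s G D).
Proof.
case: s => /= FE Fr El rE lE; last exact: FE.
by rewrite setUC; apply: FE.
Qed.

(* Cut is additive and identity contributes nothing, so succedent minus
   antecedent is a sum over the hypotheses used; the equation is written
   without subtraction. *)
Lemma derivable_balance d n (t : {ffun 'I_n -> formula n}) H S :
  derivable d t H S ->
  exists2 hs : seq (sequent n), (forall h, h \in hs -> H h) &
    S.1 `+` msum snd hs = S.2 `+` msum fst hs.
Proof.
elim=> {S} [S HS|B|X G D G' D' _ _ [hs Hhs /msetP/= eqS]
  _ [hs' Hhs' /msetP/= eqS']].
- exists [:: S]; first by move=> h; rewrite inE => /eqP ->.
  by rewrite !msum1 msetDC.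
- by exists [::] => //; apply/msetP => x; rewrite !msetE2 !msumE !big_nil.
- exists (hs ++ hs').
    by move=> h; rewrite mem_cat => /orP[/Hhs|/Hhs'].
  apply/msetP => x /=; move: (eqS x) (eqS' x).
  by rewrite !msetE2 !msumE !big_cat /=; lia.
Qed.

Lemma derivable_balance_on d n (t : {ffun 'I_n -> formula n}) H s S :
  derivable d t H S ->
  exists2 hs : seq (sequent n), (forall h, h \in hs -> H h) &
    off_side s S `+` msum (@on_side s _) hs =
    on_side s S `+` msum (@off_side s _) hs.
Proof.
by move=> /derivable_balance[hs Hhs eqS]; exists hs => //; case: s.
Qed.

Lemma blocks_map d (T U : Type) (f : T -> U) (X : seq T) :
  blocks d (map f X) = map (map f) (blocks d X).
Proof. by case: d => //=; rewrite -!map_comp. Qed.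

(** Lets active formulas be counted in the same way for both cut styles. *)
Lemma flatten_blocks d (T : Type) (X : seq T) : flatten (blocks d X) = X.
Proof. by case: d => /=; rewrite ?cats0 ?flatten_seq1. Qed.

Lemma main_step_scheme_perm d n s (A : seq (seq 'I_n)) (Y : seq 'I_n) :
  main_step_on d s [set scheme_main s A] [set scheme_opp d s Y] ->
  exists2 X, X \in A & perm_eq X Y.
Proof.
move=> step; pose t := atoms n; pose T X := msum (fun i => [mset t i]) X.
(* Fresh tags: [Atom n] marks the context of the main rule, [Atom (n.+1 + j)] the j-th context of
   the opposite rule. *)
pose c (v : nat) : {mset formula n} := [mset Atom n].
pose c' j : {mset formula n} := [mset Atom (n.+1 + j)].
pose Z := blocks d Y; pose b := size Z.
have bE : size (blocks d (map (@Sub n) Y)) = b by rewrite blocks_map size_map.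
have := @main_step_onP _ _ _ _ _ (scheme_main s A) (scheme_opp d s Y)
  t c c' (c 0) (msum c' (iota 0 b)) step erefl erefl.
rewrite !schema_inst_on !msum1 msum_Ctx bE => /(_ erefl erefl).
move=> /(@derivable_balance_on _ _ _ _ s)[hs Hhs].
(* The hypotheses used are sorted, with multiplicity, into premisses of the main rule (their lists
   [xs]) and of the opposite rule (their indices [js]). *)
have [xs [js [Axs lt_js on_hs off_hs]]] : exists xs js,
    [/\ {subset xs <= A}, (forall j, j \in js -> j < b),
        forall x, \sum_(h <- hs) on_side s h x =
          \sum_(X <- xs) T X x + \sum_(j <- js) c' j x &
        forall x, \sum_(h <- hs) off_side s h x =
          \sum_(X <- xs) c 0 x + \sum_(j <- js) T (nth [::] Z j) x].
  elim: hs Hhs => [|h hs IHhs] Hhs.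
    by exists [::], [::]; split=> // x; rewrite !big_nil.
  have [|xs [js [Axs lt_js on_hs off_hs]]] := IHhs.
    by move=> h' hs_h'; apply: Hhs; rewrite inE hs_h' orbT.
  have [] := Hhs h; first by rewrite mem_head.
    move=> [_ /mapP[X AX ->] <-]; exists (X :: xs), js; split=> //.
    - by move=> X'; rewrite inE => /orP[/eqP ->|/Axs].
    - move=> x; rewrite !big_cons on_hs addnA; congr (_ + _ + _).
      by rewrite schema_inst_on onK msum_Sub.
    - move=> x; rewrite !big_cons off_hs addnA; congr (_ + _ + _).
      by rewrite schema_inst_on offK msum1.
  move=> [p /mapP[j]]; rewrite bE mem_iota add0n /= => lt_jb -> <-.
  exists xs, (j :: js); split=> //.
  - by move=> j'; rewrite inE => /orP[/eqP ->|/lt_js].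
  - move=> x; rewrite !big_cons on_hs addnCA; congr (_ + (_ + _)).
    by rewrite schema_inst_on onK msum1.
  - move=> x; rewrite !big_cons off_hs addnCA; congr (_ + (_ + _)).
    rewrite schema_inst_on offK blocks_map (nth_map [::]) //.
    by rewrite msum_Sub.
rewrite onK offK => /msetP eq_hs.
have {eq_hs} bal x : c 0 x + (\sum_(X <- xs) T X x + \sum_(j <- js) c' j x) =
    \sum_(j <- iota 0 b) c' j x +
    (\sum_(X <- xs) c 0 x + \sum_(j <- js) T (nth [::] Z j) x).
  by move: (eq_hs x); rewrite !msetE2 !msumE on_hs off_hs.
have c'E js' k : \sum_(j <- js') c' j (Atom (n.+1 + k)) = count_mem k js'.
  rewrite -sum1_count [RHS]big_mkcond /=; apply: eq_bigr => j _.
  by rewrite msetnE eq_Atom eqn_add2l eq_sym.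
have c'_le js' k : k <= n -> \sum_(j <- js') c' j (Atom k) = 0.
  move=> le_kn; rewrite big1 // => j _; rewrite msetnE eq_Atom ltn_eqF //.
  by rewrite (leq_trans (n := n.+1)) ?leq_addr.
have T_ge (I : Type) (r : seq I) f k :
    n <= k -> \sum_(i <- r) T (f i) (Atom k) = 0.
  by move=> le_nk; rewrite big1 // => i _; apply: msum_atoms_ge.
have c_neq (I : Type) (r : seq I) k : k != n -> \sum_(i <- r) c 0 (Atom k) = 0.
  by move=> /negPf k'n; rewrite big1 // => i _; rewrite msetnE eq_Atom k'n.
(* At the tag of the main context, the balance counts the uses of premisses of the main rule against
   one occurrence in the conclusion. *)
have sz_xs : size xs = 1.
  move: (bal (Atom n)); rewrite !T_ge // !c'_le // msetnE eqxx.
  by rewrite sum1_size !addn0 add0n.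
(* At the tag of the k-th opposite context, it counts the uses of the k-th premiss. *)
have perm_js : perm_eq js (iota 0 b).
  apply/allP => k _ /=; apply/eqP; move: (bal (Atom (n.+1 + k))).
  have ge_k : n <= n.+1 + k by lia.
  have neq_k : n.+1 + k != n by lia.
  rewrite !T_ge // c_neq // !c'E msetnE eq_Atom (negPf neq_k).
  by rewrite !add0n !addn0.
case: xs sz_xs Axs bal {on_hs off_hs} => [|X []] // _ AX bal.
exists X; first by apply: AX; rewrite mem_head.
(* Below [n] no tag contributes, so only active formulas are compared. *)
apply/allP => y _ /=; apply/eqP; move: (bal (Atom (val y))).
have y_n : val y != n by rewrite neq_ltn ltn_ord.
have le_yn : val y <= n by rewrite ltnW ?ltn_ord.
rewrite !c'_le // c_neq // msetnE eq_Atom (negPf y_n).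
rewrite !addn0 !add0n big_seq1 msum_atoms_ord => ->.
rewrite (perm_big _ perm_js) /= -(flatten_blocks d Y) count_flatten.
rewrite sumnE big_map (big_nth [::]) /index_iota subn0.
by apply: eq_bigr => j _; rewrite msum_atoms_ord.
Qed.

(** * Scheme rules up to permutation of active formulas *)

Lemma same_rule_scheme_main n s (A A' : seq (seq 'I_n)) :
  (forall X, X \in A -> exists2 X', X' \in A' & perm_eq X' X) ->
  (forall X, X \in A' -> exists2 X', X' \in A & perm_eq X' X) ->
  same_rule (scheme_main s A) (scheme_main s A').
Proof.
have sub (B B' : seq (seq 'I_n)) t c :
    (forall X, X \in B -> exists2 X', X' \in B' & perm_eq X' X) ->
    (prems_inst t c (scheme_main s B) `<=`
     prems_inst t c (scheme_main s B'))%classic.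
  move=> BB' _ [_ /mapP[X BX ->] <-]; have [X' B'X' permX] := BB' X BX.
  exists (on s [:: Ctx 0] (map (@Sub n) X')); first by apply/mapP; exists X'.
  by rewrite !schema_inst_on !msum_Sub (perm_msum _ permX).
move=> AA' A'A; apply: same_ruleP => t c; exists c; congr pair;
  by apply/seteqP; split; apply: sub.
Qed.

Lemma nth_map_Sub n (B : seq (seq 'I_n)) i :
  nth [::] (map (map (@Sub n)) B) i = map (@Sub n) (nth [::] B i).
Proof. by elim: B i => [|X B IHB] [|i] //=. Qed.

(* With one-by-one cuts, permuting the active formulas permutes the contexts
   of the premisses as well, hence the reindexing of [c]. *)
Lemma same_rule_scheme_opp d n s (X Y : seq 'I_n) :
  perm_eq X Y -> same_rule (scheme_opp d s X) (scheme_opp d s Y).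
Proof.
wlog suff sub : X Y / perm_eq X Y -> forall t c, exists c',
    rule_inst t c' (scheme_opp d s X) = rule_inst t c (scheme_opp d s Y).
  by move=> permXY; apply: same_ruleP => t c; apply: sub; rewrite // perm_sym.
move=> permXY t c; case: d.
  have : perm_eq (blocks One_by_one X) (blocks One_by_one Y).
    by rewrite perm_map.
  rewrite /scheme_opp /contextualize !blocks_map !(size_map (map (@Sub n))).
  move: (blocks _ X) (blocks _ Y) => BX BY perm_B.
  (* [Is] gives for each block of [BX] its position in [BY]. *)
  have [Is permI BXE] := perm_iotaP [::] perm_B.
  have sz_I : size Is = size BX by rewrite BXE size_map.
  have IsE : map (nth 0 Is) (iota 0 (size BX)) = Is.
    by rewrite -sz_I; apply: mkseq_nth.
  exists (c \o nth 0 Is); congr pair; last first.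
    rewrite !schema_inst_on !msum_Ctx !msum1 -(msum_map c (nth 0 Is)) IsE.
    by rewrite (perm_msum _ permI).
  have premE i : i < size BX ->
      schema_inst t (c \o nth 0 Is)
        (on s (nth [::] (map (map (@Sub n)) BX) i) [:: Ctx i]) =
      schema_inst t c
        (on s (nth [::] (map (map (@Sub n)) BY) (nth 0 Is i))
              [:: Ctx (nth 0 Is i)]).
    move=> lt_i; rewrite !schema_inst_on !msum1 !nth_map_Sub !msum_Sub.
    by rewrite BXE (nth_map 0) ?sz_I.
  apply/seteqP; split=> _ [_ /mapP[i + ->] <-] /=.
    rewrite mem_iota add0n /= => lt_i; rewrite premE //; eexists; last by [].
    apply/mapP; exists (nth 0 Is i) => //.
    by rewrite -(perm_mem permI) mem_nth ?sz_I.
  rewrite -(perm_mem permI) -[X in i \in X]IsE => /mapP[j + ->].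
  rewrite mem_iota add0n /= => lt_j; rewrite -premE //; eexists; last by [].
  by apply/mapP; exists j => //; rewrite mem_iota.
(* Simultaneous cuts: there is a single premiss and context, so nothing is reindexed. *)
exists c; congr pair; rewrite /prems_inst /=.
apply/seteqP; split=> _ [p + <-] /=; rewrite /= inE => /eqP ->.
  exists (on s (map (@Sub n) Y) [:: Ctx 0]); first by rewrite mem_head.
  by rewrite !schema_inst_on !msum_Sub (perm_msum _ permXY).
exists (on s (map (@Sub n) X) [:: Ctx 0]); first by rewrite mem_head.
by rewrite !schema_inst_on !msum_Sub (perm_msum _ permXY).
Qed.

(** * Substituting C for context variables *)

Lemma subst_ctx_Ctx n K (G : seq nat) :
  subst_ctx K (map (@Ctx n) G) = nseq (count K G) Prin.
Proof.
rewrite /subst_ctx -map_comp; elim: G => //= v G ->.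
by rewrite -nseqD.
Qed.

(** Testing [K] on a singleton shows that each variable of [G] occurs once in [G']. For [v] outside
    [G], the pair of [v] and some [v0] in [G] still meets [G] once; as [v0] already accounts for the
    one occurrence in [G'], [v] has none. *)
Lemma perm_of_count1 (G G' : seq nat) :
  uniq G -> G <> [::] ->
  (forall K : pred nat, count K G = 1 -> count K G' = 1) -> perm_eq G' G.
Proof.
move=> G_uniq G_neq0 cnt; have [v0 v0_G] : exists v0, v0 \in G.
  by case: G G_neq0 {G_uniq cnt} => // v0 G _; exists v0; rewrite mem_head.
have cnt1 v : v \in G -> count_mem v G = 1.
  by move=> Gv; rewrite count_uniq_mem // Gv.
apply/allP => v _; apply/eqP => /=.
have [Gv|G'v] := boolP (v \in G); first by rewrite cnt1 // (cnt _ (cnt1 _ Gv)).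
have cntU H : count (predU (pred1 v0) (pred1 v)) H =
    count_mem v0 H + count_mem v H.
  rewrite -count_predUI [X in _ = _ + X](eq_count (a2 := pred0)).
    by rewrite count_pred0 addn0.
  by move=> u /=; case: eqP => //= ->; apply: contraNF G'v => /eqP <-.
have := cnt (predU (pred1 v0) (pred1 v)).
rewrite !cntU (count_memPn G'v) cnt1 // addn0 (cnt _ (cnt1 _ v0_G)).
by move=> /(_ erefl)[].
Qed.

(** The side of the principal formula carries no context, so its occurrences there can be counted in
    any instance: one for [r], [k] for the other rule. *)
Lemma contextualize_introduces d n s (k : nat) (X : seq (symbol n)) r :
  introduces (opp s) r ->
  same_rule r (contextualize d s (nseq k Prin) X) -> k = 1.
Proof.
move=> [[G _ rE] _] rX.
have [c _] := same_rule_inst (atoms n) (fun=> mset0) rX.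
rewrite rE on_opp !schema_inst_on => /(congr1 (@off_side s _)); rewrite !offK.
move=> /(congr1 (fun A : {mset formula n} => A (Conn (atoms n)))).
rewrite !msumE big_seq1 /= msetnE eqxx.
by rewrite big_nseq iter_addn_0 msetnE eqxx mul1n.
Qed.

(** Every sequent of an instance depends on the context variables only through the sum over [G], and
    this sum takes every value because [G] is not empty. *)
Lemma same_rule_shared_context n s (r : rule n) G
    (Q : seq (seq nat * seq 'I_n)) :
  uniq G -> G <> [::] -> concl r = on s (map Ctx G) [:: Prin] ->
  prems r = [seq on s (map Ctx q.1) (map (@Sub n) q.2) | q <- Q] ->
  (forall q, q \in Q -> perm_eq q.1 G) ->
  same_rule r (scheme_main s (map snd Q)).
Proof.
move=> G_uniq G_neq0 rE prE permQ.
have instE t c c' : msum c G = c' 0 ->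
    rule_inst t c' (scheme_main s (map snd Q)) = rule_inst t c r.
  move=> c'0; rewrite /rule_inst rE !schema_inst_on !msum1 msum_Ctx c'0.
  congr pair; rewrite /prems_inst prE /= -map_comp.
  have qE q : q \in Q ->
      schema_inst t c' (on s [:: Ctx 0] (map (@Sub n) q.2)) =
      schema_inst t c (on s (map Ctx q.1) (map (@Sub n) q.2)).
    move=> /permQ/perm_msum Gq; rewrite !schema_inst_on !msum_Sub msum1.
    by rewrite msum_Ctx Gq c'0.
  apply/seteqP; split=> _ [_ /mapP[q Qq ->] <-] /=.
    by rewrite qE //; eexists; last by []; apply/mapP; exists q.
  by rewrite -qE //; eexists; last by []; apply/mapP; exists q.
apply: same_ruleP => t c.
  by exists (fun=> msum c G); apply: instE.
case: G G_neq0 G_uniq {rE permQ} instE => // v0 G _ G_uniq instE.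
(* The whole context is put on [v0], which occurs once in the list. *)
exists (fun v => if v == v0 then c 0 else mset0); apply/esym/instE.
by rewrite msum_single ?mem_head.
Qed.

Lemma explicit_reflectionP d n s (F : set (rule n)) r G p :
  F r -> concl r = on s (map Ctx G) [:: Prin] -> p \in prems r ->
  forall K : pred nat, count K G = 1 ->
  explicit_reflection d s F
    (contextualize d s (subst_ctx K (off_side s p)) (on_side s p)).
Proof.
move=> Fr rE rp K KG; exists (concl r), p, K; split=> //.
  by exists r, p.
by rewrite rE offK subst_ctx_Ctx KG.
Qed.

(** The main rule has one context variable, so any admissible [K] replaces it, and each premiss
    yields exactly one explicit rule. *)
Lemma explicit_reflection_scheme d n s (A : seq (seq 'I_n)) :
  explicit_reflection d s [set scheme_main s A] =
  [set scheme_opp d s acts | acts in [set` A]].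
Proof.
apply/seteqP; split=> e.
  move=> [_ [_ [K [[_ [_ [-> /mapP[X AX ->] [-> ->]]]] + ->]]]].
  rewrite !offK onK (subst_ctx_Ctx _ _ [:: 0]) => ->.
  by exists X.
move=> [X AX <-].
have := @explicit_reflectionP d n s [set scheme_main s A] (scheme_main s A)
  [:: 0] (on s [:: Ctx 0] (map (@Sub n) X)) erefl erefl.
rewrite offK onK => /(_ _ xpredT erefl); apply.
by apply/mapP; exists X.
Qed.

(** * The two directions of the equivalence *)

Lemma synthetic_reflection d n s (C : connective d n) A :
  instance_of_scheme s C A -> satisfies_reflection C.
Proof.
move=> [Cs Copp]; exists s, [set scheme_main s A]; split=> //.
- split; first by exists (scheme_main s A).
  move=> _ ->; split; last by rewrite offK.
  split; first by exists [:: 0].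
  by move=> p /mapP[X _ ->]; exists [:: 0], X.
- rewrite solvableE explicit_reflection_scheme.
  apply: main_step_on_same_rules Cs Copp _.
  by case: s; apply: rules_main_step.
- by rewrite explicit_reflection_scheme.
Qed.

(* Substituting C(A_1, ..., A_n) for one context variable of the conclusion
   must leave exactly one occurrence of it in every premiss, whatever is
   substituted for the variables foreign to the conclusion. *)
Lemma formation_rule_scheme d n s (C : connective d n) F r :
  formation_rules s F ->
  same_rules (rules C (opp s)) (explicit_reflection d s F) -> F r ->
  exists2 A, same_rule r (scheme_main s A) &
    forall e, explicit_reflection d s [set r] e <->
              exists2 X, X \in A & e = scheme_opp d s X.
Proof.
move=> [_ F_intro] [_ expl] Fr; have [[[G G_uniq rE] prE]] := F_intro r Fr.
rewrite rE offK => G_neq0.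
have {}G_neq0 : G <> [::] by move=> G0; apply: G_neq0; rewrite G0.
(* Each explicit rule is identified with a rule of C, which has exactly one C in its conclusion;
   this fixes the count of [K] on [G']. *)
have permG G' X : on s (map Ctx G') (map (@Sub n) X) \in prems r ->
    perm_eq G' G.
  move=> rp; apply: perm_of_count1 => // K KG.
  have := explicit_reflectionP d Fr rE rp KG.
  rewrite offK onK subst_ctx_Ctx => /expl[r' /rules_introduce].
  exact: contextualize_introduces.
have [Q QE] : exists Q : seq (seq nat * seq 'I_n),
    prems r = [seq on s (map Ctx q.1) (map (@Sub n) q.2) | q <- Q].
  elim: (prems r) prE => [|p ps IHps] psE; first by exists [::].
  have [|Q ->] := IHps.
    by move=> p' ps_p'; apply: psE; rewrite inE ps_p' orbT.
  have [|G' [X ->]] := psE p; first by rewrite mem_head.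
  by exists ((G', X) :: Q).
have permQ q : q \in Q -> perm_eq q.1 G.
  by move=> Qq; apply: (permG _ q.2); rewrite QE; apply/mapP; exists q.
exists (map snd Q); first exact: same_rule_shared_context permQ.
move=> e; split.
  move=> [_ [_ [K [[_ [p [-> rp [-> ->]]]] + ->]]]].
  move: rp; rewrite QE => /mapP[q Qq ->].
  rewrite rE !offK onK !subst_ctx_Ctx (permP (permQ q Qq)) => ->.
  by exists q.2 => //; apply/mapP; exists q.
move=> [_ /mapP[q Qq ->] ->]; case: G G_neq0 G_uniq rE permQ {permG} => //.
move=> v0 G _ G_uniq rE permQ.
(* Replacing just [v0] by C is a substitution that produces the explicit rule. *)
have v0G : count_mem v0 (v0 :: G) = 1 by rewrite count_uniq_mem // mem_head.
have := @explicit_reflectionP d n s [set r] r (v0 :: G)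
  (on s (map Ctx q.1) (map (@Sub n) q.2)) erefl rE.
rewrite offK onK => /(_ _ _ v0G).
rewrite subst_ctx_Ctx (permP (permQ q Qq)) v0G; apply.
by rewrite QE; apply/mapP; exists q.
Qed.

(** Allows the formation rules to be analysed one at a time. *)
Lemma explicit_reflectionE d n s (F : set (rule n)) e :
  explicit_reflection d s F e <->
  exists2 r, F r & explicit_reflection d s [set r] e.
Proof.
split=> [[S [p [K [[r [q [Fr rq eqi]] SK ->]]]]]|].
  by exists r => //; exists S, p, K; split=> //; exists r, q.
move=> [r Fr [S [p [K [[_ [q [-> rq eqi]] SK ->]]]]]].
by exists S, p, K; split=> //; exists r, q.
Qed.

Lemma reflection_synthetic d n s (C : connective d n) F :
  formation_rules s F -> solvable d s F ->
  same_rules (rules C s) F ->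
  same_rules (rules C (opp s)) (explicit_reflection d s F) ->
  exists A, instance_of_scheme s C A.
Proof.
move=> formF; rewrite solvableE => solF CF CE.
have scheme r := @formation_rule_scheme d n s C F r formF CE.
(* Solvability also pairs [r] with the explicit rules of another formation rule [r']; used in both
   directions, this makes their lists agree up to permutation. *)
have sub r r' (A A' : seq (seq 'I_n)) :
    F r -> same_rule r (scheme_main s A) -> F r' ->
    (forall e, explicit_reflection d s [set r'] e <->
               exists2 X, X \in A' & e = scheme_opp d s X) ->
    forall X, X \in A' -> exists2 X', X' \in A & perm_eq X' X.
  move=> Fr rA Fr' expl X A'X; apply: (@main_step_scheme_perm d n s).
  have {}solF : main_step_on d s [set r] [set scheme_opp d s X].
    have eX : explicit_reflection d s F (scheme_opp d s X).
      by apply/explicit_reflectionE; exists r' => //; apply/expl; exists X.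
    by case: (s) solF eX => /= step eX r1 l1 -> ->; apply: step.
  apply: main_step_on_same_rules solF; last first.
    by split=> e ->; exists (scheme_opp d s X).
  by split=> _ ->; eexists.
(* Any formation rule can supply the scheme, since all the others coincide with it. *)
have [[r0 Fr0] _] := formF; have [A r0A explA] := scheme r0 Fr0.
exists A; split.
  apply: same_rules_trans CF _; split=> [r Fr|_ ->]; last by exists r0.
  exists (scheme_main s A) => //; have [A' rA' explA'] := scheme r Fr.
  apply: (same_rule_trans rA'); apply: same_rule_scheme_main.
    exact: sub Fr0 r0A Fr explA'.
  exact: sub Fr rA' Fr0 explA.
apply: same_rules_trans CE _; split=> [e|_ [X AX <-]].
  move=> /explicit_reflectionE[r Fr]; have [A' rA' explA'] := scheme r Fr.
  move=> /explA'[X A'X ->].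
  have [X' AX' permX] := sub r0 r A A' Fr0 r0A Fr explA' X A'X.
  exists (scheme_opp d s X'); first by exists X'.
  by apply: same_rule_scheme_opp; rewrite perm_sym.
exists (scheme_opp d s X) => //; apply/explicit_reflectionE.
by exists r0 => //; apply/explA; exists X.
Qed.

Theorem theorem2 (d : cut_style) (n : nat) (C : connective d n) :
  satisfies_reflection C <-> synthetic C.
Proof.
split=> [[s [F [formF solF CF CE]]]|[A [] /synthetic_reflection //]].
have [A CA] := reflection_synthetic formF solF CF CE.
by exists A; case: s CA {formF solF CF CE} => CA; [right|left].
Qed.
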